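(* Let $n,k,\gamma$ be positive integers with $\gamma+1\le k<3\lceil\gamma/2\rceil$ and $n\ge2k+\gamma$. Then $$B_2(n,k,k+\gamma;3)\ge 2^{2\left\lfloor\frac{n-2k+1}{k+1}\right\rfloor}.$$
   Context: For a prime power $q$, $\mathcal{G}_q(n,k)$ denotes the set of all $k$-dimensional subspaces of $\mathbb{F}_q^n$. An $\alpha$-$(n,k,\delta)_q^c$ covering Grassmannian code is a subset $\mathcal{C}\subseteq\mathcal{G}_q(n,k)$ (no repeated codewords) such that every set of $\alpha$ distinct codewords of $\mathcal{C}$ spans a subspace of $\mathbb{F}_q^n$ of dimension at least $k+\delta$. $B_q(n,k,\delta;\alpha)$ denotes the maximum size of an $\alpha$-$(n,k,\delta)_q^c$ code. *)

(* Defs.v *)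
From HB Require Import structures.
From mathcomp Require Import all_boot all_order all_algebra all_field.
Set Implicit Arguments. Unset Strict Implicit. Unset Printing Implicit Defensive.
Import GRing.Theory.
Local Open Scope ring_scope.

Definition covering_code (F : finFieldType) (n k delta alpha : nat)
    (C : seq {vspace 'rV[F]_n}) : Prop :=
  [/\ uniq C,
      (forall U, U \in C -> \dim U = k) &
      (forall S : seq {vspace 'rV[F]_n},
         uniq S -> size S = alpha -> {subset S <= C} ->
         (k + delta <= \dim (\sum_(U <- S) U)%VS)%N)].

(* Main.v *)
Require Import Defs.
From HB Require Import structures.
From mathcomp Require Import all_boot all_order all_algebra all_field.
From mathcomp Require Import zify ring.
Set Implicit Arguments.
Unset Strict Implicit.
Unset Printing Implicit Defensive.
Import GRing.Theory VectorInternalTheory.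
Local Open Scope ring_scope.

(** The codewords are the graphs {(u, B x u)} of the linear maps B x given by a
    bilinear map B : X x U -> Y with dim U = k and k + dim Y <= n.  The graphs
    of B x, B y and B z span dimension 3k - d, where d is the dimension of the
    solution space of B p u + B q v = 0 for p = x - z and q = y - z; over F_2,
    p and q are merely distinct and nonzero.  Put m = floor((n-2k+1)/(k+1)).

    If gamma = 1, let B be the multiplication of polynomials over F_2, with U
    the polynomials of degree < k.  Solutions (u, v) of p u + q v = 0 are
    determined by u, so if d = k there are solutions (1, v) and (X^(k-1), w).
    Then w = X^(k-1) v, hence v is a constant and p is a scalar multiple of q,
    which is impossible.  So d < k.

    If gamma > 1, then k >= 3.  For m > 0 let X = L be the field of order 2^N
    with N = max(k, 2m), embed U in L and take B x u = (x u, x u^2).  Then d = 0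
    since p u + q v = p u^2 + q v^2 = 0 yields q v (v - u) = 0.  For m = 0 a
    single codeword suffices. *)

Lemma exists_lker0_lfun (F : fieldType) (V W : vectType F) :
  (dim V <= dim W)%N -> exists f : 'Hom(V, W), lker f == 0%VS.
Proof.
move=> leVW; exists (Hom (pid_mx (dim V))).
by rewrite -dimv_eq0 /dimv mx2vsK mxrank_ker rank_pid_mx ?subnn.
Qed.

Lemma dim_limg_lker0 (F : fieldType) (V W : vectType F) (f : 'Hom(V, W))
    (U : {vspace V}) :
  lker f == 0%VS -> \dim (f @: U) = \dim U.
Proof. by move=> /eqP f_inj; rewrite limg_dim_eq // f_inj capv0. Qed.

Lemma dim_limg_leq (F : fieldType) (V W : vectType F) (f : 'Hom(V, W))
    (U : {vspace V}) :
  (\dim (f @: U) <= \dim U)%N.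
Proof. by rewrite -[leqRHS](limg_ker_dim f) leq_addl. Qed.

Lemma dim_rV (R : nzRingType) n : dim 'rV[R]_n = n.
Proof. exact: mul1n. Qed.

Lemma dim_prod (R : nzRingType) (V W : vectType R) :
  dim (V * W)%type = (dim V + dim W)%N.
Proof. by []. Qed.

Section Graphs.

Variables (F : fieldType) (U Y : vectType F).
Implicit Types (f g h : 'Hom(U, Y)) (w : U * Y).

Definition graph f : {vspace U * Y} := lker (linfun (snd \- (f \o fst))).

Definition copair_lfun f g : 'Hom((U * U)%type, Y) :=
  linfun ((f \o fst) \+ (g \o snd)).

Lemma copair_lfunE f g u v : copair_lfun f g (u, v) = f u + g v.
Proof. by rewrite lfunE. Qed.

Lemma memv_graph f w : (w \in graph f) = (w.2 == f w.1).
Proof. by rewrite memv_ker lfunE subr_eq0. Qed.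

Lemma graph_inj : injective graph.
Proof.
move=> f g eq_fg; apply/lfunP => u; apply/eqP.
by rewrite -(memv_graph g (u, f u)) -eq_fg memv_graph.
Qed.

Lemma limg_fst_graph f : (linfun fst @: graph f = fullv)%VS.
Proof.
apply/vspaceP => u; rewrite memvf.
have -> : u = linfun (@fst U Y) (u, f u) by rewrite lfunE.
by rewrite memv_img // memv_graph.
Qed.

Lemma dim_graph f : \dim (graph f) = dim U.
Proof.
rewrite -(limg_ker_dim (linfun fst)) limg_fst_graph dimvf.
suff -> : (graph f :&: lker (linfun fst) = 0)%VS by rewrite dimv0.
apply/eqP; rewrite -subv0; apply/subvP => -[u y].
rewrite memv_cap memv_graph memv_ker lfunE memv0 /=.
by case/andP => /eqP-> /eqP->; rewrite linear0.
Qed.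

Lemma dim_sum_graphs f g h :
  (3 * dim U <= \dim (graph f + (graph g + graph h))
    + \dim (lker (copair_lfun (f - h)%R (g - h)%R)))%N.
Proof.
set S := (_ + _)%VS; set d := copair_lfun _ _.
have fst_S : (linfun fst @: S = fullv)%VS.
  by rewrite !limgD !limg_fst_graph !addvv.
have d_sub : (limg d <= linfun snd @: (S :&: lker (linfun fst)))%VS.
  apply/subvP => _ /memv_imgP [[u v] _ ->]; rewrite copair_lfunE.
  have -> : (f - h) u + (g - h) v = linfun (@snd U Y)
      ((u, f u) + ((v, g v) + (- (u + v), h (- (u + v))))).
    rewrite [RHS]lfunE /= !lfun_simp linearN linearD opprD.
    by rewrite addrACA [RHS]addrA.
  apply: memv_img; rewrite memv_cap; apply/andP; split.
    by do ?[apply: memv_add]; rewrite memv_graph.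
  by rewrite memv_ker lfunE /= addrA subrr.
have dim_d : (\dim (lker d) + \dim (limg d) = dim U + dim U)%N.
  by rewrite -[lker d]capfv limg_ker_dim dimvf.
rewrite -(limg_ker_dim (linfun fst) S) fst_S dimvf !mulSn addn0 -dim_d.
rewrite addnC [leqRHS]addnAC leq_add2r addnC leq_add2r.
exact: leq_trans (dimvS d_sub) (dim_limg_leq _ _).
Qed.

End Graphs.

Section CoveringCodes.

Variables (F : finFieldType) (n : nat).

Lemma covering_code_codom (k delta alpha : nat) (I : finType)
    (c : I -> {vspace 'rV[F]_n}) :
    injective c -> (forall x, \dim (c x) = k) ->
    (forall s : seq I, uniq s -> size s = alpha ->
       (k + delta <= \dim (\sum_(x <- s) c x)%VS)%N) ->
  covering_code k delta alpha (codom c).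
Proof.
move=> c_inj dim_c dim_sum; split.
- by rewrite map_inj_uniq ?enum_uniq.
- by move=> _ /codomP [x ->].
move=> S S_uniq size_S /subset_mapP [s _ def_S]; move: S_uniq size_S.
by rewrite def_S map_inj_uniq // size_map big_map; apply: dim_sum.
Qed.

(* The bound B_q(n, k, delta; alpha) >= N, for q = #|F|. *)
Definition max_code_ge k delta alpha N : Prop :=
  exists C : seq {vspace 'rV[F]_n},
    covering_code k delta alpha C /\ (N <= size C)%N.

Lemma leq_max_code_ge k delta delta' alpha N N' :
    (delta' <= delta)%N -> (N' <= N)%N ->
  max_code_ge k delta alpha N -> max_code_ge k delta' alpha N'.
Proof.
move=> le_delta le_N [C [[C_uniq dim_C dim_sum] size_C]].
exists C; split; last exact: leq_trans size_C.
split=> // S S_uniq size_S sub_S; apply: leq_trans (dim_sum S _ _ _) => //.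
by rewrite leq_add2l.
Qed.

Lemma max_code_ge1 k delta alpha :
  (k <= n)%N -> (1 < alpha)%N -> max_code_ge k delta alpha 1.
Proof.
move=> le_kn alpha_gt1.
have [|e e_inj] := @exists_lker0_lfun F 'rV_k 'rV_n; first by rewrite !dim_rV.
exists [:: limg e]; split=> //; split=> //.
  by move=> U; rewrite inE => /eqP->; rewrite dim_limg_lker0 // dimvf dim_rV.
move=> S S_uniq size_S sub_S.
by have := uniq_leq_size S_uniq sub_S; rewrite size_S leqNgt alpha_gt1.
Qed.

Lemma max_code_ge_graphs (U Y : vectType F) (I : finType) (A : I -> 'Hom(U, Y))
    gamma :
    (dim U + dim Y <= n)%N -> injective A ->
    (forall x y z, uniq [:: x; y; z] ->
       (\dim (lker (copair_lfun (A x - A z)%R (A y - A z)%R)) + gamma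
          <= dim U)%N) ->
  max_code_ge (dim U) (dim U + gamma) 3 #|I|.
Proof.
move=> dimUY A_inj dim_ker.
have [|e e_inj] := @exists_lker0_lfun F (U * Y)%type 'rV_n.
  by rewrite dim_prod dim_rV.
pose c x := (e @: graph (A x))%VS.
exists (codom c); split; last by rewrite size_codom.
apply: covering_code_codom => [x y /eqP|x|].
- by rewrite eq_limg_ker0 // => /eqP /graph_inj /A_inj.
- by rewrite dim_limg_lker0 ?dim_graph.
move=> [|x [|y [|z [|? ?]]]] //= /dim_ker dim_xyz _.
rewrite !big_cons big_nil addv0 -!limgD dim_limg_lker0 //.
rewrite -(leq_add2r (\dim (lker (copair_lfun (A x - A z)%R (A y - A z)%R)))).
apply: leq_trans (dim_sum_graphs _ _ _).
by rewrite !mulSn addn0 -!addnA !leq_add2l addnC.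
Qed.

End CoveringCodes.

Lemma max_code_ge_F2_bilinear n gamma (X U Y : vectType 'F_2)
    (B : {bilinear X -> U -> Y}) :
    (dim U + dim Y <= n)%N -> (forall x, B x =1 \0 -> x = 0) ->
    (forall p q : X, p != 0 -> q != 0 -> p != q ->
      (\dim (lker (copair_lfun (linfun (B p)) (linfun (B q)))) + gamma
         <= dim U)%N) ->
  max_code_ge ('F_2 : finFieldType) n (dim U) (dim U + gamma) 3 (2 ^ dim X).
Proof.
move=> dimUY B_inj dim_ker.
have -> : (2 ^ dim X)%N = #|{: 'rV['F_2]_(dim X)}|.
  by rewrite card_mx card_Fp // mul1n.
pose A (x : 'rV['F_2]_(dim X)) := linfun (B (r2v x)).
have AB x y : A x - A y = linfun (B (r2v (x - y))).
  by apply/lfunP => u; rewrite !lfun_simp linearB /= linearBl.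
have r2v_inj := @r2v_inj 'F_2 X.
apply: (max_code_ge_graphs (A := A)) => // [x y eqA|x y z].
  apply/eqP; rewrite -subr_eq0 -(raddf_eq0 _ r2v_inj); apply/eqP/B_inj => u.
  by rewrite -lfunE -AB eqA subrr zero_lfunE.
rewrite !AB /= !inE negb_or andbT => /andP [/andP [xy xz] yz].
apply: dim_ker; rewrite ?raddf_eq0 ?subr_eq0 //.
by rewrite (inj_eq r2v_inj) (inj_eq (addIr _)).
Qed.

Section PolynomialMultiplication.

Variables (R : comNzRingType) (r k : nat).
Implicit Types (p : {poly_r R}) (u : {poly_k R}).

Definition npoly_mul p u : {poly_(r + k).-1 R} :=
  npolyp (r + k).-1 (polyn p * polyn u).

Lemma npoly_mulE p u : npoly_mul p u = polyn p * polyn u :> {poly R}.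
Proof.
apply: npolypK; apply: leq_trans (size_polyMleq p u) _.
by rewrite -!subn1 leq_sub2r ?leq_add.
Qed.

Lemma npoly_mul_is_bilinear : bilinear_for *:%R *:%R npoly_mul.
Proof.
split=> [u|p] a v w; apply: val_inj; rewrite /= !npoly_mulE.
  by rewrite linearP /= mulrDl scalerAl.
by rewrite linearP /= mulrDr scalerAr.
Qed.

HB.instance Definition _ :=
  bilinear_isBilinear.Build R _ _ _ *:%R *:%R npoly_mul npoly_mul_is_bilinear.

End PolynomialMultiplication.

Lemma ltn_dim_syzygies (F : fieldType) k (p q : {poly F})
    (K : {vspace {poly_k F} * {poly_k F}}) :
    (0 < k)%N -> q != 0 -> (forall c, p != c *: q) ->
    (forall u v, (u, v) \in K -> p * polyn u + q * polyn v = 0) ->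
  (\dim K < k)%N.
Proof.
move=> k_gt0 q_neq0 pq_indep K_syz.
have fst_inj : (K :&: lker (linfun fst) = 0)%VS.
  apply/eqP; rewrite -subv0; apply/subvP => -[u v].
  rewrite memv_cap memv_ker memv0 lfunE /= => /andP [/K_syz + /eqP u0].
  move/eqP; rewrite u0 mulr0 add0r mulf_eq0 (negPf q_neq0) => /eqP v0.
  by apply/eqP; congr (_, _); apply: val_inj.
rewrite ltnNge; apply/negP => le_k.
have fst_K u : exists v, (u, v) \in K.
  have fst_full : (linfun fst @: K = fullv)%VS.
    by apply/eqP; rewrite eqEdim subvf dim_polyn limg_dim_eq.
  have /memv_imgP [[u' v] Kuv ->] : u \in (linfun fst @: K)%VS.
    by rewrite fst_full memvf.
  by exists v; rewrite lfunE.
have [[v /K_syz syz_v] [w /K_syz syz_w]] :=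
  (fst_K (npolyp k 1), fst_K (npolyp k 'X^(k.-1))).
rewrite npolypK ?size_poly1 // mulr1 in syz_v.
rewrite npolypK ?size_polyXn ?prednK // in syz_w.
have def_w : polyn w = polyn v * 'X^(k.-1).
  apply: (mulfI q_neq0); apply: (addrI (p * 'X^(k.-1))).
  by rewrite syz_w mulrA -mulrDl syz_v mul0r.
have v_const : (size v <= 1)%N.
  have [->|v_neq0] := eqVneq (polyn v) 0; first by rewrite size_poly0.
  have := size_npoly w; rewrite def_w size_mulXn //.
  by rewrite -[k in (_ <= k)%N](prednK k_gt0) -addn1 leq_add2l.
move/eqP: syz_v; rewrite (size1_polyC v_const) addr_eq0 mulrC.
rewrite mul_polyC -scaleNr.
by apply/negP/pq_indep.
Qed.

Lemma F2_eq0_or_eq1 (a : 'F_2) : (a == 0) || (a == 1).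
Proof. by case: a => -[|[|]]. Qed.

Lemma max_code_ge_npoly_mul n k : (0 < k)%N -> (2 * k <= n)%N ->
  max_code_ge ('F_2 : finFieldType) n k k.+1 3 (2 ^ (n + 1 - 2 * k)).
Proof.
move=> k_gt0 le_2kn; set r := (n + 1 - 2 * k)%N.
have dim_npoly m : dim {poly_m 'F_2} = m by rewrite -dimvf dim_polyn.
have := @max_code_ge_F2_bilinear n 1 _ _ _ (@npoly_mul 'F_2 r k).
rewrite !dim_npoly addn1; apply=> [|p mul_p0|p q p_neq0 q_neq0 pq].
- by lia.
- have /(congr1 val) := mul_p0 (npolyp k 1).
  by rewrite /= npoly_mulE npolypK ?size_poly1 // mulr1 => p0; apply: val_inj.
rewrite addn1; apply: (@ltn_dim_syzygies _ _ (polyn p) (polyn q)) => // [c|u v].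
- by case/orP: (F2_eq0_or_eq1 c) => /eqP->; rewrite ?scale0r ?scale1r.
rewrite memv_ker copair_lfunE !lfunE /= => /eqP/(congr1 val).
by rewrite /= !npoly_mulE.
Qed.

Lemma additive_Fp_scalable p (V W : lmodType 'F_p) (f : {additive V -> W}) :
  scalable f.
Proof. by move=> a v; rewrite -[a]natr_Zp !scaler_nat raddfMn. Qed.

Section FrobeniusMultiplication.

Variables (p : nat) (L : fieldExtType 'F_p) (charLp : p \in [pchar L]).
Variables (U : vectType 'F_p) (i : 'Hom(U, L)).

Definition frobenius_mul (x : L) (u : U) : L * L :=
  (x * i u, x * pFrobenius_aut charLp (i u)).

Lemma frobenius_mul_is_bilinear : bilinear_for *:%R *:%R frobenius_mul.
Proof.
split=> [u|x] a v w; rewrite /frobenius_mul.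
  by congr (_, _); rewrite /= mulrDl scalerAl.
rewrite linearP /= rmorphD additive_Fp_scalable.
by congr (_, _); rewrite /= mulrDr scalerAr.
Qed.

HB.instance Definition _ :=
  bilinear_isBilinear.Build 'F_p _ _ _ *:%R *:%R frobenius_mul
    frobenius_mul_is_bilinear.

End FrobeniusMultiplication.

Lemma linear_quadratic_eq0 (R : idomainType) (a b u v : R) :
    a != 0 -> b != 0 -> a + b != 0 ->
    a * u + b * v = 0 -> a * u ^+ 2 + b * v ^+ 2 = 0 ->
  u = 0 /\ v = 0.
Proof.
move=> /mulfI a_reg b_neq0 /mulfI ab_reg lin0 quad0.
have /eqP : b * (v * (v - u)) = 0.
  transitivity (a * u ^+ 2 + b * v ^+ 2 - u * (a * u + b * v)); first by ring.
  by rewrite lin0 quad0 mulr0 subrr.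
rewrite !mulf_eq0 (negPf b_neq0) subr_eq0 /= => /orP [] /eqP v_eq.
  by split=> //; apply: a_reg; rewrite mulr0 -lin0 v_eq mulr0 addr0.
suff u0 : u = 0 by rewrite v_eq u0.
by apply: ab_reg; rewrite mulr0 mulrDl -lin0 v_eq.
Qed.

Lemma exists_Fp_extension p N : prime p -> (0 < N)%N ->
  exists2 L : fieldExtType 'F_p, p \in [pchar L] & dim L = N.
Proof.
move=> p_pr N_gt0; have [L charL cardL] := pPrimePowerField p_pr N_gt0.
exists (pPrimeCharType charL : fieldExtType 'F_p) => //.
by rewrite -dimvf pprimeChar_dimf cardL pfactorK.
Qed.

Lemma max_code_ge_frobenius_mul n k N :
    (0 < k)%N -> (k <= N)%N -> (k + 2 * N <= n)%N ->
  max_code_ge ('F_2 : finFieldType) n k (k + k) 3 (2 ^ N).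
Proof.
move=> k_gt0 le_kN le_n.
have [//||L charL dimL] := @exists_Fp_extension 2 N; first by lia.
have [|i /lker0P i_inj] := @exists_lker0_lfun 'F_2 'rV_k L.
  by rewrite dim_rV dimL.
have := @max_code_ge_F2_bilinear n k _ _ _ (frobenius_mul charL i).
rewrite dim_rV dim_prod dimL; apply=> [|x mul_x0|a b a_neq0 b_neq0 ab].
- by lia.
- have [+ _] := mul_x0 (const_mx 1).
  move/eqP; rewrite mulf_eq0 (raddf_eq0 _ i_inj) => /orP [/eqP //|].
  by move/eqP/rowP/(_ (Ordinal k_gt0)); rewrite !mxE => /eqP; rewrite oner_eq0.
rewrite -[leqRHS]add0n leq_add2r leqn0 dimv_eq0 -subv0; apply/subvP => -[u v].
rewrite memv_ker memv0 copair_lfunE !lfunE => /eqP [lin0 quad0].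
have ab_neq0 : a + b != 0 by rewrite -(oppr_pchar2 charL b) subr_eq0.
have [/eqP + /eqP] := linear_quadratic_eq0 a_neq0 b_neq0 ab_neq0 lin0 quad0.
by rewrite !(raddf_eq0 _ i_inj) => /eqP-> /eqP->.
Qed.

Theorem mainTheorem11 (n k gamma : nat) :
  (0 < n)%N -> (0 < k)%N -> (0 < gamma)%N ->
  (gamma + 1 <= k)%N -> (k < 3 * ((gamma + 1) %/ 2))%N ->
  (2 * k + gamma <= n)%N ->
  exists C : seq {vspace 'rV['F_2]_n},
    @covering_code ('F_2 : finFieldType) n k (k + gamma) 3 C /\
    (2 ^ (2 * ((n + 1 - 2 * k) %/ (k + 1))) <= size C)%N.
Proof.
move=> _ k_gt0 gamma_gt0 gamma_lt _ le_n.
have := leq_divM (n + 1 - 2 * k) (k + 1); set m := (_ %/ _)%N => le_m.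
have [gamma1|gamma_gt1] : gamma = 1%N \/ (1 < gamma)%N by lia.
  apply: leq_max_code_ge (max_code_ge_npoly_mul k_gt0 _).
  - by rewrite gamma1 addn1.
  - by rewrite leq_exp2l //; apply: leq_trans le_m; nia.
  - by lia.
have [->|m_gt0] := posnP m.
  by apply: max_code_ge1; lia.
pose N := maxn k (2 * m).
apply: leq_max_code_ge (max_code_ge_frobenius_mul (N := N) k_gt0 _ _).
- by lia.
- by rewrite leq_exp2l // leq_maxr.
- by rewrite leq_maxl.
- by nia.
Qed.
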